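(* Let $B=(V,E)$ be a finite bipartite multigraph with at least one edge, and let $t\colon V\to\mathbb{N}$ be a function that takes the constant value $t_1$ on one block and the constant value $t_2$ on the other block of the bipartition of $B$. Then $$\chi^t(B)\,=\,\chi'(B)+t_1+t_2\,=\,\Delta(B)+t_1+t_2.$$
   Context: $\mathbb{N}=\{0,1,2,\dots\}$, $\mathbb{Z}^+=\{1,2,\dots\}$, and $\mathcal{P}(\mathbb{Z}^+)$ is the power set of $\mathbb{Z}^+$. A multigraph may have several parallel edges between two vertices, but every edge $uv=\{u,v\}$ has two distinct ends. The blocks of a bipartition are its two vertex classes (every edge has one end in each). $\Delta(B)$ is the maximal degree (edges counted with multiplicity). An edge coloring is a map $c'\colon E\to\{1,\dots,m\}$ with $c'(e)\neq c'(f)$ for any two distinct edges $e,f$ sharing at least one end; $\chi'(B)$ (chromatic index) is the smallest $m\in\mathbb{Z}^+$ for which such a map exists. For a multi-labeling $c\colon V\to\mathcal{P}(\mathbb{Z}^+)$, an edge coloring $c'$ avoids $c$ if $c'(e)\notin\bigcup_{v\in e}c(v)$ for every $e\in E$. The $c$-avoiding chromatic index $\chi'_c(B)$ is the smallest $m\in\mathbb{Z}^+$ for which there is an edge coloring $c'\colon E\to\{1,\dots,m\}$ that avoids $c$. A $t$-labeling is a multi-labeling $c$ with $|c(v)|\le t(v)$ for all $v\in V$. The $t$-avoiding chromatic index is $\chi^t(B):=\max\{\chi'_c(B) : c \text{ is a } t\text{-labeling}\}$. *)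

(* Defs.v *)
From HB Require Import structures.
From mathcomp Require Import all_boot all_order finmap.
From mathcomp Require Import boolp classical_sets functions cardinality.

Set Implicit Arguments.
Unset Strict Implicit.
Unset Printing Implicit Defensive.

(* Parallel edges are distinct elements of [edge] with the same ends. *)
Record multigraph := Multigraph {
  vertex : finType;
  edge : finType;
  ends : edge -> {set vertex};
  card_ends : forall e, #|ends e| = 2
}.

Definition bipartition (B : multigraph) (X Y : {set vertex B}) : Prop :=
  [/\ X :|: Y = [set: vertex B], [disjoint X & Y]
    & forall e : edge B, #|ends e :&: X| = 1 /\ #|ends e :&: Y| = 1].

Definition degree (B : multigraph) (v : vertex B) : nat :=
  #|[set e : edge B | v \in ends e]|.

Definition max_degree (B : multigraph) : nat :=
  \max_(v : vertex B) degree v.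

Definition edge_coloring (B : multigraph) (m : nat) (f : edge B -> nat) : Prop :=
  (forall e, 1 <= f e <= m) /\
  (forall e e' v, e != e' -> v \in ends e -> v \in ends e' -> f e != f e').

Local Open Scope classical_set_scope.

(* Both return 0 when no such element exists. *)
Definition least (S : set nat) : nat :=
  xget 0 [set m | S m /\ forall k, S k -> m <= k].

Definition greatest (S : set nat) : nat :=
  xget 0 [set m | S m /\ forall k, S k -> k <= m].

Definition chromatic_index (B : multigraph) : nat :=
  least [set m | 0 < m /\ exists f : edge B -> nat, edge_coloring m f].

Definition multi_labeling (B : multigraph) (c : vertex B -> set nat) : Prop :=
  forall v, c v `<=` [set k | 0 < k].

Definition avoids (B : multigraph) (c : vertex B -> set nat)
    (f : edge B -> nat) : Prop :=
  forall e, ~ (\bigcup_(v in [set` ends e]) c v) (f e).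

(* This is the default value 0 if no avoiding coloring exists, which can only
   happen for labelings with infinite labels; see [least_avoidingP]. *)
Definition avoiding_chromatic_index (B : multigraph)
    (c : vertex B -> set nat) : nat :=
  least [set m | 0 < m /\
    exists2 f : edge B -> nat, edge_coloring m f & avoids c f].

Definition t_labeling (B : multigraph) (t : vertex B -> nat)
    (c : vertex B -> set nat) : Prop :=
  multi_labeling c /\ forall v, (c v #<= `I_(t v))%card.

(* A positive value is a genuine, attained maximum, since [greatest] defaults
   to 0. *)
Definition t_avoiding_chromatic_index (B : multigraph)
    (t : vertex B -> nat) : nat :=
  greatest [set avoiding_chromatic_index c | c in [set c | t_labeling t c]].

Lemma leastP (S : set nat) :
  S !=set0 -> S (least S) /\ forall k, S k -> least S <= k.
Proof.
move=> [n Sn]; rewrite /least.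
have exS : exists n, `[< S n >] by exists n; apply/asboolP.
case: (ex_minnP exS) => m /asboolP Sm minm.
apply: (@xgetPex _ 0 [set m | S m /\ forall k, S k -> m <= k]).
by exists m; split=> // k Sk; apply: minm; apply/asboolP.
Qed.

Lemma t_labeling_bounded (B : multigraph) (t : vertex B -> nat)
    (c : vertex B -> set nat) :
  t_labeling t c -> exists N, forall v k, c v k -> k <= N.
Proof.
move=> [_ ct].
have bnd v : exists N, forall k, c v k -> k <= N.
  have /finite_fsetP[F cF] := card_le_finite (ct v) (finite_II _).
  exists (\max_(i <- F) i) => k; rewrite cF /= => kF.
  exact: leq_bigmax_seq.
have /choice[N HN] := bnd.
exists (\max_v N v) => v k /HN kN.
exact: leq_trans kN (leq_bigmax v).
Qed.

Lemma avoiding_coloring_exists (B : multigraph) (t : vertex B -> nat)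
    (c : vertex B -> set nat) : t_labeling t c ->
  [set m | 0 < m /\
    exists2 f : edge B -> nat, edge_coloring m f & avoids c f] !=set0.
Proof.
move=> /t_labeling_bounded[N HN].
exists (N + #|edge B|).+1; split=> //.
exists (fun e => (N + enum_rank e).+1).
- split=> [e|e e' v ee' _ _]; first by rewrite /= ltnS leq_add2l ltnW.
  by rewrite eqSS eqn_add2l; apply: contraNneq ee' => /val_inj/enum_rank_inj->.
- by move=> e [v _ /HN]; rewrite ltnNge leq_addr.
Qed.

Lemma least_avoidingP (B : multigraph) (t : vertex B -> nat)
    (c : vertex B -> set nat) (m := avoiding_chromatic_index c) :
  t_labeling t c ->
  [/\ 0 < m, exists2 f : edge B -> nat, edge_coloring m f & avoids c f
    & forall k, 0 < k ->
        (exists2 f : edge B -> nat, edge_coloring k f & avoids c f) -> m <= k].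
Proof.
move=> /avoiding_coloring_exists/leastP[[m0 mf] minm].
by split=> // k k0 kf; apply: minm.
Qed.

(* Main.v *)
(* Upper bound: removing the labels at the two ends of an edge from
   {1, ..., Delta + t1 + t2} leaves at least Delta colors, so an avoiding
   coloring exists by Galvin's theorem on list edge colorings of bipartite
   multigraphs.  Galvin's theorem is derived from a Konig coloring [k] with Delta
   colors: orient the line graph towards larger [k] around one class and smaller
   [k] around the other, so that out-degrees are below Delta and every set of
   edges has a kernel, and color kernel by kernel.
   Lower bound: labelling one class by {1, ..., t1} and the other by
   {t1 + 1, ..., t1 + t2} forbids the colors 1, ..., t1 + t2 on every edge. *)
Require Import Defs.
From mathcomp Require Import boolp classical_sets functions cardinality.
From mathcomp Require Import all_boot.

Set Implicit Arguments.
Unset Strict Implicit.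
Unset Printing Implicit Defensive.

(** * Proper colorings and counting of colors *)

(** A bipartite multigraph is encoded by its two end maps [px] and [py]. Restricting to a set [A]
    lets the inductions below delete edges without changing the edge type. *)
Definition proper_on (E : finType) (U W K : eqType) (px : E -> U) (py : E -> W)
    (A : {set E}) (k : E -> K) : Prop :=
  {in A &, forall e e', (px e == px e') || (py e == py e') -> k e = k e' -> e = e'}.

Lemma card_le_range (E : finType) (A : {set E}) (k : E -> nat) (a b : nat) :
  {in A &, injective k} -> (forall e, e \in A -> a <= k e < b) ->
  #|A| <= b - a.
Proof.
move=> kinj kab; rewrite cardE -(size_map k) -(size_iota a (b - a)).
apply: uniq_leq_size => [|_ /mapP[e + ->]].
  by rewrite map_inj_in_uniq ?enum_uniq // => e e'; rewrite !mem_enum; apply: kinj.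
rewrite mem_enum mem_iota => /kab /andP[ake keb]; rewrite ake.
by rewrite subnKC // ltnW // (leq_ltn_trans ake).
Qed.

Lemma missing_color (E : finType) (A : {set E}) (k : E -> nat) (D : nat) :
  #|A| < D -> exists2 a, a < D & {in A, forall e, k e != a}.
Proof.
move=> AD; have [/existsP[a /forall_inP ka]|] :=
  boolP [exists a : 'I_D, [forall e in A, k e != a]]; first by exists a.
rewrite negb_exists => /forallP all_used; suff: D <= #|A| by rewrite leqNgt AD.
rewrite cardE -(size_map k) -[D in D <= _](size_iota 0).
apply: uniq_leq_size => [|a]; first exact: iota_uniq.
rewrite mem_iota => /andP[_ aD]; have := all_used (Ordinal aD).
rewrite negb_forall_in => /existsP[e /andP[eA /negPn/eqP/= <-]].
by rewrite map_f // mem_enum.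
Qed.

(** * Konig's edge coloring theorem by Kempe chains *)

Lemma connect_last (T : finType) (r : rel T) (x y : T) :
  connect r x y -> y = x \/ exists2 z, connect r x z & r z y.
Proof.
move=> /connectP[p]; case/lastP: p => [_ ->|p z]; first by left.
rewrite rcons_path last_rcons => /andP[xp rz] ->; right.
by exists (last x p) => //; apply/connectP; exists p.
Qed.

(* The [a]-[b]-alternating chain leaving [w] through its [a]-edge enters
   vertices on the [px] side through [a]-edges only, so it avoids [u] and
   swapping the two colors along it frees [a] at [w]. *)
Lemma kempe_swap (E : finType) (U W : eqType) (px : E -> U) (py : E -> W)
    (A : {set E}) (k : E -> nat) (D a b : nat) (u : U) (w : W) :
  proper_on px py A k -> {in A, forall e, k e < D} -> a < D -> b < D ->
  {in A, forall e, px e == u -> k e != a} ->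
  {in A, forall e, py e == w -> k e != b} ->
  exists k' : E -> nat, [/\ proper_on px py A k', {in A, forall e, k' e < D},
    {in A, forall e, px e == u -> k' e != a} &
    {in A, forall e, py e == w -> k' e != a}].
Proof.
move=> kP kD aD bD ua wb.
have [/existsP[e0 /and3P[e0A /eqP e0w /eqP e0a]]|] :=
  boolP [exists e, [&& e \in A, py e == w & k e == a]]; last first.
  rewrite negb_exists => /forallP wa; exists k; split=> // e eA ew.
  by have := wa e; rewrite eA ew.
have nab : a != b by rewrite -e0a wb ?e0w.
(* The chain is directed: it leaves an [a]-edge at its [px] end and a [b]-edge at its [py] end. *)
pose step g h := [&& g \in A, h \in A &
  [&& k g == a, k h == b & px g == px h] ||
  [&& k g == b, k h == a & py g == py h]].
pose S := [set g | connect step e0 g].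
have S0 : e0 \in S by rewrite inE.
have S1 g h : g \in S -> step g h -> h \in S.
  by rewrite !inE => e0g gh; apply: connect_trans e0g (connect1 gh).
have SI g : g \in S -> g = e0 \/ exists2 h, h \in S & step h g.
  rewrite inE => /connect_last[->|[h e0h hg]]; [by left | right].
  by exists h; rewrite ?inE.
have Sab g : g \in S -> g \in A /\ (k g = a \/ k g = b).
  case/SI=> [->|[h _ /and3P[_ gA]]]; first by split=> //; left.
  by case/orP=> /and3P[_ /eqP kg _]; split=> //; [right|left].
have Sb g : g \in S -> k g = b ->
    exists h, [/\ h \in S, h \in A, k h = a & px h == px g].
  move=> gS kg; case: (SI g gS) => [ge|[h hS /and3P[hA gA]]].
    by move: nab; rewrite -kg ge e0a eqxx.
  case/orP=> /and3P[/eqP kh /eqP kg' hg]; first by exists h.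
  by move: nab; rewrite -kg' kg eqxx.
have Sa g : g \in S -> k g = a -> py g = w \/
    exists h, [/\ h \in S, h \in A, k h = b & py h == py g].
  move=> gS kg; case: (SI g gS) => [->|[h hS /and3P[hA gA]]]; first by left.
  case/orP=> /and3P[/eqP kh /eqP kg' hg]; last by right; exists h.
  by move: nab; rewrite -kg' kg eqxx.
pose k' g := if g \in S then if k g == a then b else a else k g.
(* Suppose [h] clashes with the recolored [g]. At the end where the chain leaves [g], [h] would
   continue the chain. At the end where it enters [g], [h] would be the preceding edge by properness
   or, at [w], would have the missing color [b]. *)
have mixed g h : g \in S -> h \in A -> h \notin S ->
    (px g == px h) || (py g == py h) -> k' g = k h -> False.
  move=> gS hA hS gh; rewrite /k' gS; have [gA [kg|kg]] := Sab g gS.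
    rewrite kg eqxx => /esym kh; case/orP: gh => gh.
      by move/negP: hS; apply; apply: S1 gS _; rewrite /step gA hA kg kh gh !eqxx.
    case: (Sa g gS kg) => [gw|[h' [h'S h'A kh' h'g]]].
      by have := wb h hA; rewrite -(eqP gh) gw kh !eqxx => /(_ isT).
    move: hS; rewrite -(kP h' h h'A hA) ?h'S ?kh' ?kh //.
    by rewrite (eqP h'g) gh orbT.
  rewrite kg eq_sym (negbTE nab) => /esym kh; case/orP: gh => gh.
    have [h' [h'S h'A kh' h'g]] := Sb g gS kg.
    move: hS; rewrite -(kP h' h h'A hA) ?h'S ?kh' ?kh //.
    by rewrite (eqP h'g) gh.
  move/negP: hS; apply; apply: S1 gS _.
  by rewrite /step gA hA kg kh gh !eqxx orbT.
have k'a g : g \in A -> k' g = a -> (g \in S /\ k g = b) \/ (g \notin S /\ k g = a).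
  move=> gA; rewrite /k'; case: (boolP (g \in S)) => [gS|]; last by right.
  have [_ [kg|kg]] := Sab g gS; last by left.
  by rewrite kg eqxx => ba; rewrite ba eqxx in nab.
exists k'; split.
- move=> g h gA hA gh.
  case: (boolP (g \in S)) => gS; case: (boolP (h \in S)) => hS.
  + rewrite /k' gS hS; have [_ kg] := Sab g gS; have [_ kh] := Sab h hS.
    move: nab; case: kg kh => [kg|kg] [kh|kh] nab; try by move=> _; apply: kP;
      rewrite // kg kh.
      by rewrite kg kh eqxx eq_sym (negbTE nab) => /eqP; rewrite eq_sym (negbTE nab).
    by rewrite kg kh eqxx eq_sym (negbTE nab) => /eqP; rewrite (negbTE nab).
  + by move=> e; case: (mixed g h gS hA hS gh); rewrite e /k' (negbTE hS).
  + move=> e; case: (mixed h g hS gA gS); last by rewrite -e /k' (negbTE gS).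
    by rewrite eq_sym [py h == _]eq_sym.
  + by rewrite /k' (negbTE gS) (negbTE hS); apply: kP.
- by move=> g gA; rewrite /k'; do 2?case: ifP => // _; apply: kD.
(* A chain edge at [u] recolored from [b] to [a] would have been entered through an [a]-edge at
   [u]. *)
- move=> g gA gu; apply/negP => /eqP /(k'a g gA) [[gS kg]|[_ kg]].
    have [h [_ hA kh hg]] := Sb g gS kg.
    by have := ua h hA; rewrite (eqP hg) gu kh eqxx => /(_ isT).
  by have := ua g gA gu; rewrite kg eqxx.
- move=> g gA gw; apply/negP => /eqP /(k'a g gA) [[_ kg]|[gS kg]].
    by have := wb g gA gw; rewrite kg eqxx.
  move: gS; rewrite -(kP e0 g e0A gA) ?S0 ?e0a ?kg //.
  by rewrite e0w (eqP gw) eqxx orbT.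
Qed.

(** Induction on the number of edges: color all edges but [e], pick a color missing at each end of
    [e], and use a Kempe swap to make the first of them missing at both ends. *)
Lemma konig_edge_coloring (E : finType) (U W : eqType) (px : E -> U) (py : E -> W)
    (D : nat) (A : {set E}) :
  (forall u, #|[set e in A | px e == u]| <= D) ->
  (forall w, #|[set e in A | py e == w]| <= D) ->
  exists2 k : E -> nat, proper_on px py A k & {in A, forall e, k e < D}.
Proof.
have [n] := ubnP #|A|; elim: n A => // n IHn A0 An dX dY.
have [A00|[e eA0]] := set_0Vmem A0.
  by exists (fun=> 0) => [? ?|?]; rewrite A00 inE.
have [A A0E eA] : exists2 A, A0 = e |: A & e \notin A.
  by exists (A0 :\ e); rewrite ?setD1K ?setD11.
rewrite {}A0E cardsU1 eA add1n ltnS in An dX dY *; have {}IHn := IHn A An.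
have sub (P : pred E) : [set g in A | P g] \subset [set g in e |: A | P g].
  by apply/subsetP => g; rewrite !inE => /andP[-> ->]; rewrite orbT.
have [u|w|k kP kD] := IHn; [exact: leq_trans (subset_leq_card (sub _)) (dX u)
  | exact: leq_trans (subset_leq_card (sub _)) (dY w) |].
(* The uncolored edge [e] takes one of the at most [D] places at each of its ends, so the edges of
   [A] there leave a color free. *)
have missing (P : pred E) : P e -> #|[set g in e |: A | P g]| <= D ->
    exists2 a, a < D & {in A, forall g, P g -> k g != a}.
  move=> Pe dP; case: (@missing_color E [set g in A | P g] k D).
    apply: leq_trans dP; apply: proper_card; rewrite properE sub.
    by apply/subsetPn; exists e; rewrite !inE ?eqxx ?(negbTE eA).
  by move=> a aD ka; exists a => // g gA Pg; apply: ka; rewrite inE gA.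
have [a aD ua] := missing (fun g => px g == px e) (eqxx _) (dX (px e)).
have [b bD wb] := missing (fun g => py g == py e) (eqxx _) (dY (py e)).
have [k' [k'P k'D k'u k'w]] := kempe_swap kP kD aD bD ua wb.
have ne g : g \in A -> (g == e) = false by apply: contraTF => /eqP->.
have k'e g : g \in A -> (px g == px e) || (py g == py e) -> k' g <> a.
  by move=> gA /orP[/(k'u g gA)|/(k'w g gA)] /eqP.
exists (fun g => if g == e then a else k' g).
- move=> g h; rewrite !inE.
  case/orP=> [/eqP->|gA]; case/orP=> [/eqP->|hA] //; rewrite ?eqxx ?ne //.
  + by rewrite eq_sym [py e == _]eq_sym => /(k'e h hA) + /esym.
  + by move/(k'e g gA).
  + exact: k'P.
- by move=> g; rewrite !inE; case: eqP => //= _; apply: k'D.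
Qed.

(** * Kernels and Galvin's theorem *)

(* Existence of a stable matching, for the preferences of larger [k] at [px]
   and of smaller [k] at [py]. *)
Lemma bipartite_kernel (E : finType) (U W : eqType) (px : E -> U) (py : E -> W)
    (k : E -> nat) (T : {set E}) :
  proper_on px py T k ->
  exists K : {set E}, [/\ K \subset T,
    {in K &, forall e e', (px e == px e') || (py e == py e') -> e = e'} &
    {in T :\: K, forall e, exists2 h, h \in K &
       (px h == px e) && (k e < k h) || (py h == py e) && (k h < k e)}].
Proof.
have [n] := ubnP #|T|; elim: n T => // n IH T Tn kP.
pose top e := [forall g in T, (px g == px e) ==> (k g <= k e)].
have topP e g : top e -> g \in T -> px g == px e -> k g <= k e.
  by move=> /forall_inP te gT ge; apply: (implyP (te g gT)).
(* Deferred acceptance: [e'] is the favorite at its [px] end and beats [e] at their common [py] end,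
   so [e] can be rejected. In the end [e'] is in the kernel and dominates [e], or it is dominated,
   necessarily at [py], by an edge that then dominates [e] too. *)
have [/existsP[e /existsP[e' /and5P[eT e'T te' yee' kee']]]|noclash] :=
  boolP [exists e, exists e', [&& e \in T, e' \in T, top e', py e' == py e & k e' < k e]].
  have [||K [KT Kind Kdom]] := IH (T :\ e).
  - by move: Tn; rewrite (cardsD1 e T) eT.
  - by move=> g h /setD1P[_ gT] /setD1P[_ hT]; apply: kP.
  exists K; split=> //; first by apply: subset_trans KT (subsetDl _ _).
  move=> g /setDP[gT gK]; case: (eqVneq g e) => [->|ge]; last first.
    by apply: Kdom; rewrite !inE ge gK gT.
  have [e'K|e'K] := boolP (e' \in K); first by exists e'; rewrite // yee' kee' orbT.
  have [|h hK] := Kdom e'.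
    by rewrite !inE e'K e'T andbT; apply: contraTneq kee' => ->; rewrite ltnn.
  case/orP=> /andP[he' kh]; exists h => //.
    have hT : h \in T by have /setD1P[] := subsetP KT h hK.
    by have := topP _ _ te' hT he'; rewrite leqNgt kh.
  by rewrite (eqP he') yee' (ltn_trans kh kee') orbT.
have clash e e' : e \in T -> e' \in T -> top e' -> py e' == py e -> k e <= k e'.
  move=> eT e'T te' yee'; rewrite leqNgt; apply/negP => kee'.
  move/existsP: noclash; apply; exists e; apply/existsP; exists e'.
  by rewrite eT e'T te' yee' kee'.
(* Without a clash the favorites of the [px] side already form a kernel. *)
exists [set e in T | top e]; split.
- by apply/subsetP => e; rewrite inE => /andP[].
- move=> e e'; rewrite !inE => /andP[eT te] /andP[e'T te'] ee'.
  apply: kP => //; apply/eqP; rewrite eqn_leq; case/orP: ee' => ee'.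
    by rewrite !topP // eq_sym.
  by rewrite !clash // eq_sym.
- move=> e /setDP[eT]; rewrite inE eT /= negb_forall_in => /existsP[g /andP[gT]].
  rewrite negb_imply -ltnNge => /andP[ge keg].
  have eE : (e \in T) && (px e == px e) by rewrite eT eqxx.
  case: (@arg_maxnP _ e (fun h => (h \in T) && (px h == px e)) k eE) => h.
  move=> /andP[hT he] hmax; exists h.
    rewrite inE hT; apply/forall_inP => h' h'T; apply/implyP => h'h.
    by apply: hmax; rewrite h'T (eqP h'h).
  by rewrite he (leq_trans keg) //; apply: hmax; rewrite gT.
Qed.

(** The two cardinals add up to the out-degree of [e]. Give a color [al] to a kernel of the edges
    that allow it, then delete [al] from the remaining lists: an edge whose list shrinks also loses
    an out-neighbor in the kernel, so the strict inequality survives. *)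
Lemma galvin_list_coloring (E C : finType) (U W : eqType) (px : E -> U)
    (py : E -> W) (k : E -> nat) (c0 : C) (A : {set E}) (L : E -> {set C}) :
  proper_on px py A k ->
  {in A, forall e, #|[set g in A | (px g == px e) && (k e < k g)]| +
    #|[set g in A | (py g == py e) && (k g < k e)]| < #|L e|} ->
  exists2 f : E -> C, proper_on px py A f & {in A, forall e, f e \in L e}.
Proof.
have [n] := ubnP #|A|; elim: n A L => // n IH A L An kP LA.
have [->|[e eA]] := set_0Vmem A; first by exists (fun=> c0) => [? ?|?]; rewrite inE.
have /card_gt0P[al alL] : 0 < #|L e| by apply: leq_ltn_trans (LA e eA).
pose T := [set g in A | al \in L g].
have [g h|K [KT Kind Kdom]] := @bipartite_kernel E U W px py k T.
  by rewrite !inE => /andP[gA _] /andP[hA _]; apply: kP.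
have KA : K \subset A by apply: subset_trans KT _; apply/subsetP => g; rewrite inE => /andP[].
(* The kernel is nonempty because [e] allows [al] and so lies in it or is dominated by it; hence the
   induction advances. *)
have [g0 g0K] : exists g, g \in K.
  have [eK|eK] := boolP (e \in K); first by exists e.
  by have [|h hK _] := Kdom e; [rewrite !inE eK eA | exists h].
have sub (P : pred E) : [set g in A :\: K | P g] \subset [set g in A | P g].
  by apply/subsetP => g; rewrite !inE => /andP[/andP[_ ->]].
have [|g h /setDP[gA _] /setDP[hA _]||f fP fL] := IH (A :\: K) (fun g => L g :\ al).
- move: An; rewrite ltnS; apply: leq_trans; apply: proper_card.
  rewrite properE subsetDl; apply/subsetPn.
  by exists g0; rewrite ?inE ?g0K ?(subsetP KA).
- exact: kP.
- move=> g /setDP[gA gK].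
  have [alg|alg] := boolP (al \in L g); last first.
    have -> : #|L g :\ al| = #|L g| by rewrite [RHS](cardsD1 al) (negbTE alg).
    by apply: leq_ltn_trans (LA g gA); apply: leq_add; apply/subset_leq_card/sub.
  have := LA g gA; rewrite (cardsD1 al (L g)) alg add1n ltnS; apply: leq_trans.
  have [|h hK] := Kdom g; first by rewrite !inE gK gA.
  have lt (P : pred E) : P h -> #|[set g in A :\: K | P g]| < #|[set g in A | P g]|.
    move=> Ph; apply: proper_card; rewrite properE sub.
    by apply/subsetPn; exists h; rewrite !inE ?Ph ?hK ?(subsetP KA).
  case/orP=> dom.
    rewrite -addSn; apply: leq_add; last exact/subset_leq_card/sub.
    exact: (lt (fun g' => (px g' == px g) && (k g < k g'))).
  rewrite -addnS; apply: leq_add; first exact/subset_leq_card/sub.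
  exact: (lt (fun g' => (py g' == py g) && (k g' < k g))).
have fal g : g \in A -> g \notin K -> f g \in L g /\ f g <> al.
  move=> gA gK; have := fL g; rewrite !inE gK gA => /(_ isT) /andP[/eqP ? ?].
  by split.
exists (fun g => if g \in K then al else f g).
- move=> g h gA hA gh; case: ifPn => gK; case: ifPn => hK.
  + by move=> _; apply: Kind.
  + by move=> /esym; have [] := fal h hA hK.
  + by have [] := fal g gA gK.
  + by apply: fP => //; rewrite inE ?gK ?hK.
- move=> g gA; case: ifPn => gK; last by have [] := fal g gA gK.
  by have := subsetP KT g gK; rewrite inE => /andP[].
Qed.

Lemma galvin (E C : finType) (U W : eqType) (px : E -> U) (py : E -> W)
    (D : nat) (c0 : C) (L : E -> {set C}) :
  (forall u, #|[set e | px e == u]| <= D) ->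
  (forall w, #|[set e | py e == w]| <= D) ->
  (forall e, D <= #|L e|) ->
  exists2 f : E -> C, proper_on px py setT f & forall e, f e \in L e.
Proof.
move=> dX dY LD.
have [u|w|k kP kD] := @konig_edge_coloring E U W px py D setT.
- by apply: leq_trans (dX u); apply/subset_leq_card/subsetP => e; rewrite !inE.
- by apply: leq_trans (dY w); apply/subset_leq_card/subsetP => e; rewrite !inE.
have [e _|f fP fL] := @galvin_list_coloring E C U W px py k c0 setT L (kP); last first.
  by exists f => // e; apply: fL.
apply: leq_trans (LD e); have ke := kD e (in_setT e).
(* Of the colors below [D], [D - 1 - k e] exceed [k e] and [k e] lie below it, so the out-degree is
   at most [D - 1]. *)
apply: (@leq_ltn_trans ((D - (k e).+1) + (k e - 0))); last first.
  by rewrite subn0 -ltnS -addnS addnC -addSn; rewrite addSn subnKC.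
apply: leq_add; apply: (@card_le_range _ _ k).
- move=> g h; rewrite !inE => /= /andP[gx _] /andP[hx _]; apply: kP; rewrite ?inE //.
  by rewrite (eqP gx) (eqP hx) eqxx.
- by move=> g; rewrite !inE => /= /andP[_ ->]; rewrite kD.
- move=> g h; rewrite !inE => /= /andP[gx _] /andP[hx _]; apply: kP; rewrite ?inE //.
  by rewrite (eqP gx) (eqP hx) eqxx orbT.
- by move=> g; rewrite !inE => /= /andP[_ ->].
Qed.

(** * Extremal values and sizes of labels *)

Lemma least_eq (S : set nat) (m : nat) :
  S m -> (forall k, S k -> m <= k) -> least S = m.
Proof.
move=> Sm minm; have [Sl minl] := leastP (ex_intro _ m Sm).
by apply/eqP; rewrite eqn_leq minl // minm.
Qed.

Lemma greatest_eq (S : set nat) (m : nat) :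
  S m -> (forall k, S k -> k <= m) -> greatest S = m.
Proof.
move=> Sm maxm; rewrite /greatest.
have [|Sg maxg] := @xgetPex _ 0 [set n | S n /\ forall k, S k -> k <= n]%classic.
  by exists m.
by apply/eqP; rewrite eqn_leq maxm // maxg.
Qed.

Lemma card_ord_label (S : set nat) (n m : nat) :
  (S #<= `I_n)%card -> #|[set i : 'I_m | `[< S i >]]| <= n.
Proof.
move=> /pcard_leP[f]; rewrite -[n]subn0; apply: (@card_le_range _ _ (fun i => f (val i))).
  move=> i j; rewrite !inE => /asboolP Si /asboolP Sj /inj fij.
  by apply: val_inj; apply: fij; apply: mem_set.
by move=> i; rewrite inE => /asboolP Si; apply: (@funS _ _ _ _ f).
Qed.

Lemma card_interval_label (a n : nat) :
  ([set k | (a < k <= a + n)%N]%classic #<= `I_n)%card.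
Proof.
apply: card_le_trans (card_image_le (fun i => (a + i).+1) `I_n%classic).
apply: subset_card_le => k /= /andP[ak kan]; exists (k - a.+1) => /=.
  by rewrite -(ltn_add2l a.+1) subnKC // addSn ltnS.
by rewrite -addSn subnKC.
Qed.

(** * The two bounds for avoiding colorings, and the theorem *)

Lemma bipartition_ends (B : multigraph) (X Y : {set vertex B}) :
  bipartition X Y -> exists px py : edge B -> vertex B,
    forall e, [/\ px e \in X, py e \in Y & ends e = [set px e; py e]].
Proof.
move=> [XY _ eXY].
have ex e : exists p : vertex B * vertex B,
    [/\ p.1 \in X, p.2 \in Y & ends e = [set p.1; p.2]].
  have [/eqP/cards1P[x ex] /eqP/cards1P[y ey]] := eXY e; exists (x, y) => /=.
  have : x \in ends e :&: X by rewrite ex set11.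
  have : y \in ends e :&: Y by rewrite ey set11.
  rewrite !inE => /andP[_ ->] /andP[_ ->]; split=> //.
  by rewrite -[LHS]setIT -XY setIUr ex ey.
have /choice[p pP] := ex.
by exists (fun e => (p e).1), (fun e => (p e).2).
Qed.

Lemma avoiding_coloring_upper (B : multigraph) (X Y : {set vertex B})
    (t : vertex B -> nat) (t1 t2 : nat) (c : vertex B -> set nat) :
  bipartition X Y ->
  (forall v, v \in X -> t v = t1) -> (forall v, v \in Y -> t v = t2) ->
  t_labeling t c ->
  exists2 f : edge B -> nat, edge_coloring (max_degree B + t1 + t2) f & avoids c f.
Proof.
move=> bip tX tY [_ ct]; have [px [py eP]] := bipartition_ends bip.
have dis v : v \in X -> v \in Y -> False.
  by case: bip => _ /pred0P /(_ v) /= + _ vX vY; rewrite vX vY.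
set m := max_degree B + t1 + t2.
(* Colors live in ['I_m.+1], with [ord0] removed from every list because colors start at 1. Labels
   above [m] forbid nothing and are cut off. *)
pose lab v := [set i : 'I_m.+1 | `[< c v i >]].
pose L e := ~: (ord0 |: (lab (px e) :|: lab (py e))).
have deg (p : edge B -> vertex B) : (forall e, p e \in ends e) ->
    forall v, #|[set e | p e == v]| <= max_degree B.
  move=> pe v; apply: leq_trans (leq_bigmax v); apply/subset_leq_card/subsetP.
  by move=> e; rewrite !inE => /eqP <-.
have [| |e|f fP fL] := @galvin _ _ _ _ px py (max_degree B) ord0 L.
- by apply: deg => e; have [_ _ ->] := eP e; rewrite set21.
- by apply: deg => e; have [_ _ ->] := eP e; rewrite set22.
- have [eX eY _] := eP e.
  have Le : #|~: L e| <= 1 + (t1 + t2).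
    rewrite setCK; apply: leq_trans (leq_card_setU _ _) _; rewrite cards1 leq_add2l.
    apply: leq_trans (leq_card_setU _ _) _.
    by apply: leq_add; apply: card_ord_label; rewrite -?(tX _ eX) -?(tY _ eY).
  rewrite -(leq_add2r #|~: L e|) cardsC card_ord.
  by apply: leq_trans (leq_add (leqnn _) Le) _; rewrite add1n addnS addnA.
exists (fun e => val (f e)).
- split=> [e|e e' v nee' ve ve'].
    have := fL e; rewrite in_setC in_setU1 => /norP[f0 _].
    by rewrite lt0n f0 -ltnS ltn_ord.
  apply: contraNN nee' => /eqP/val_inj ff'; apply/eqP; apply: (fP) => //.
  have [eX eY eE] := eP e; have [e'X e'Y e'E] := eP e'.
  move: ve ve'; rewrite eE e'E !inE.
  case/orP=> /eqP-> /orP[] /eqP vv'; rewrite ?vv' ?eqxx ?orbT //.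
  + by case: (dis (py e')); rewrite // -vv'.
  + by case: (dis (py e)); rewrite // vv'.
- move=> e [v /= ve cv]; have [_ _ eE] := eP e.
  have := fL e; rewrite in_setC in_setU1 in_setU !in_set.
  move=> /norP[_ /norP[/asboolPn nx /asboolPn ny]].
  move: ve; rewrite eE !inE => /orP[] /eqP ve; rewrite ve in cv; [exact: nx | exact: ny].
Qed.

Lemma edge_coloring_lower (B : multigraph) (m s : nat) (f : edge B -> nat) :
  0 < #|edge B| -> edge_coloring m f -> (forall e, s < f e) ->
  max_degree B + s <= m.
Proof.
move=> /card_gt0P[e0 _] [fm fP] sf.
(* The existing edge [e0] ensures that the truncated difference [m - s] is genuine. *)
have sm : s <= m.
  by have /andP[_ fe] := fm e0; apply: leq_trans (ltnW (sf e0)) fe.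
rewrite addnC -leq_subRL //; apply/bigmax_leqP => v _.
(* The shift turns the bound into the length of the half-open range from [s.+1] to [m.+1], which
   holds the colors at [v]. *)
rewrite -subSS; apply: (@card_le_range _ _ f).
  move=> e e'; rewrite !inE => ve ve' ff'; apply/eqP; apply: contraT => ee'.
  by have := fP e e' v ee' ve ve'; rewrite ff' eqxx.
by move=> e _; rewrite sf ltnS; have /andP[] := fm e.
Qed.

Theorem corollary2p6 (B : multigraph) (X Y : {set vertex B})
    (t : vertex B -> nat) (t1 t2 : nat) :
  bipartition X Y ->
  0 < #|edge B| ->
  (forall v, v \in X -> t v = t1) ->
  (forall v, v \in Y -> t v = t2) ->
  t_avoiding_chromatic_index t = chromatic_index B + t1 + t2 /\
  chromatic_index B + t1 + t2 = max_degree B + t1 + t2.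
Proof.
move=> bip E0 tX tY; have [px [py eP]] := bipartition_ends bip.
have D0 : 0 < max_degree B.
  have /card_gt0P[e _] := E0; apply: leq_trans (leq_bigmax (px e)).
  by apply/card_gt0P; exists e; have [_ _ eE] := eP e; rewrite inE eE set21.
(* Konig's theorem is the case of empty labels: both bounds are applied with [t1 = t2 = 0] and
   [s = 0]. *)
have -> : chromatic_index B = max_degree B.
  apply: least_eq => [|m [_ [f fm]]].
    split=> //; have [//|//||f fm _] := @avoiding_coloring_upper B X Y (fun=> 0) 0 0
      (fun=> classical_sets.set0) bip.
      by split=> v; [exact: classical_sets.sub0set | exact: card_ge0].
    by exists f; rewrite !addn0 in fm.
  rewrite -[max_degree B]addn0; apply: (edge_coloring_lower E0 fm) => e.
  by have [/(_ e) /andP[]] := fm.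
split=> //; apply: greatest_eq => [|_ [c ct <-]]; last first.
  have [_ _ ->//] := least_avoidingP ct; first by rewrite -addnA addn_gt0 D0.
  exact: avoiding_coloring_upper bip tX tY ct.
(* The extremal labeling; [0 + t1] is written to match [card_interval_label]. *)
pose c v : set nat := if v \in X then [set k | (0 < k <= 0 + t1)%N]%classic
  else [set k | (t1 < k <= t1 + t2)%N]%classic.
have ct : t_labeling t c.
  split=> v; rewrite /c; case: ifPn => vX.
  - by move=> k /= /andP[].
  - by move=> k /= /andP[/(leq_ltn_trans (leq0n _))].
  - by rewrite tX //; apply: card_interval_label.
  - rewrite tY; first exact: card_interval_label.
    by case: bip => /setP /(_ v) + _ _; rewrite !inE (negbTE vX).
exists c => //; apply/eqP; rewrite eqn_leq; have [_ [f fm fc] min_] := least_avoidingP ct.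
rewrite min_ /=; [|by rewrite -addnA addn_gt0 D0|exact: avoiding_coloring_upper bip tX tY ct].
rewrite -addnA; apply: (edge_coloring_lower E0 fm) => e.
rewrite ltnNge; apply/negP => fe; apply: (fc e).
have [eX eY eE] := eP e; have [/(_ e)/andP[f0 _] _] := fm.
(* A color at most [t1 + t2] lies in the label of the [X]-end if it is at most [t1], and in that of
   the [Y]-end otherwise. *)
have [ft|ft] := leqP (f e) t1.
  by exists (px e); rewrite /= ?eE ?set21 // /c eX /= f0.
exists (py e); rewrite /= ?eE ?set22 // /c ifN /= ?ft //.
case: bip => _ + _; rewrite disjoint_sym => /pred0P /(_ (py e)) /=.
by rewrite eY => /negbT.
Qed.
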